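(* Let $A\in\mathbb{R}^{m\times n}$, $F\in\mathbb{R}^{n\times k}$, $b\in\mathbb{R}^m$, $\mathcal{B}\subseteq\{1,\dots,n\}$, and $\mathcal{X}:=\{x\in\mathbb{R}^n: Ax=b,\ x\ge 0,\ x_j\in\{0,1\}\ \forall j\in\mathcal{B}\}$. Let $\widehat\Xi\subseteq\mathbb{R}_+\times\mathbb{R}^{k-1}$ be a closed, convex, full-dimensional cone and let $\Xi:=\{\xi\in\widehat\Xi:\xi_1=1\}$ be nonempty. Assume that $\mathcal{X}$ is nonempty and bounded; that $Ax=b$, $x\ge0$ imply $0\le x_j\le1$ for all $j\in\mathcal{B}$; and that $\Xi$ is bounded. Let $\hat\xi_1,\dots,\hat\xi_N\in\Xi$, $\widehat{\mathbb{P}}_N:=\frac1N\sum_{i=1}^N\delta_{\hat\xi_i}$, $\epsilon>0$, and let $r>0$ be such that $\xi^T\xi+x^Tx\le r$ for all $\xi\in\Xi$, $x\in\mathcal{X}$. Define $v(\xi):=\max\{(F\xi)^Tx:x\in\mathcal{X}\}$ and $$v^+_{\mathcal{D}(\widehat{\mathbb{P}}_N,\epsilon)}:=\sup\Big\{\int_\Xi v(\xi)\,d\mathbb{Q}(\xi)\;:\;\mathbb{Q}\in\mathcal{M}^2(\Xi),\ W^2(\mathbb{Q},\widehat{\mathbb{P}}_N)\le\epsilon\Big\}.$$ Let $\mathrm{IA}(\widehat\Xi)$ be any set with $\mathrm{IA}(\widehat\Xi)\subseteq\mathcal{COP}(\widehat\Xi)$, let $\mathrm{IA}(\widehat\Xi\times\mathbb{R}^n_+)$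 be the associated set defined in the context, and let $\bar v^+_{\mathcal{D}(\widehat{\mathbb{P}}_N,\epsilon)}$ be the optimal value of $$\begin{array}{ll}\min & \lambda\epsilon^2+\frac1N\sum_{i=1}^N(\alpha^i+r\rho^i)\\[2pt] \text{s.t.} & \alpha^i g_1g_1^T-H^i(\lambda)+E^T\mathrm{Diag}(u^i)E+\sum_{j\in\mathcal{B}}v^i_jQ_j+\rho^iI\in\mathrm{IA}(\widehat\Xi\times\mathbb{R}^n_+)\quad\forall i\in\{1,\dots,N\}\\[2pt] & \rho^i\ge0\quad\forall i\in\{1,\dots,N\},\qquad \lambda\ge0,\end{array}$$ with variables $\lambda\in\mathbb{R}$ and $\alpha^i,\rho^i\in\mathbb{R}$, $u^i\in\mathbb{R}^m$, $v^i\in\mathbb{R}^{|\mathcal{B}|}$ for $i=1,\dots,N$. Then $$v^+_{\mathcal{D}(\widehat{\mathbb{P}}_N,\epsilon)}\le\bar v^+_{\mathcal{D}(\widehat{\mathbb{P}}_N,\epsilon)}.$$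
   Context: $\delta_\zeta$ is the Dirac distribution at $\zeta$, $\|\cdot\|$ is the Euclidean norm, and $\mathbb{S}^d$ is the space of symmetric $d\times d$ real matrices. $\mathcal{M}^2(\Xi)$ is the set of probability distributions $\mathbb{Q}$ supported on $\Xi$ with $\int_\Xi\|\xi-\xi'\|^2d\mathbb{Q}(\xi)<\infty$ for some reference point $\xi'\in\Xi$. The 2-Wasserstein distance between $\mathbb{Q},\mathbb{Q}'\in\mathcal{M}^2(\Xi)$ is $$W^2(\mathbb{Q},\mathbb{Q}'):=\inf_\Pi\Big(\int_{\Xi^2}\|\xi-\xi'\|^2\,\Pi(d\xi,d\xi')\Big)^{1/2},$$ the infimum being over joint distributions $\Pi$ of $(\xi,\xi')$ with marginals $\mathbb{Q}$ and $\mathbb{Q}'$. For a closed convex cone $\mathcal{K}\subseteq\mathbb{R}^d$, $\mathcal{COP}(\mathcal{K}):=\{M\in\mathbb{S}^d: z^TMz\ge0\ \forall z\in\mathcal{K}\}$, and $\mathcal{K}^*$ denotes the dual cone of $\mathcal{K}$. Given $\mathrm{IA}(\widehat\Xi)\subseteq\mathcal{COP}(\widehat\Xi)$, define $$\mathrm{IA}(\widehat\Xi\times\mathbb{R}^n_+):=\Big\{S+M:\ S,M\in\mathbb{S}^{k+n},\ S_{11}\in\mathrm{IA}(\widehat\Xi),\ \mathrm{Rows}(S_{21})\in\widehat\Xi^*,\ S_{22}\ge0,\ M\succeq0\Big\},$$ where $S=\begin{pmatrix}S_{11}&S_{21}^T\\S_{21}&S_{22}\end{pmatrix}$ with $S_{11}\in\mathbb{S}^k$,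 $S_{21}\in\mathbb{R}^{n\times k}$, $S_{22}\in\mathbb{S}^n$; $\mathrm{Rows}(S_{21})\in\widehat\Xi^*$ means every row of $S_{21}$ (as a vector in $\mathbb{R}^k$) lies in $\widehat\Xi^*$; $S_{22}\ge0$ is entrywise; $M\succeq0$ means positive semidefinite. Let $e_1$ be the first standard basis vector of $\mathbb{R}^k$, $f_j$ the $j$-th standard basis vector of $\mathbb{R}^n$, and $g_1:=\binom{e_1}{0}\in\mathbb{R}^{k+n}$. $\mathrm{Diag}(u)$ is the diagonal matrix with diagonal $u$, and $I$ is the identity matrix of appropriate size. Define $$E:=\begin{pmatrix}-be_1^T & A\end{pmatrix}\in\mathbb{R}^{m\times(k+n)},$$ $$H^i(\lambda):=\begin{pmatrix}-\lambda\big(I-\hat\xi_ie_1^T-e_1\hat\xi_i^T+\|\hat\xi_i\|^2e_1e_1^T\big) & \frac12F^T\\ \frac12F & 0\end{pmatrix}\in\mathbb{S}^{k+n},$$ $$Q_j:=\binom{0}{f_j}\binom{0}{f_j}^T-\tfrac12\binom{0}{f_j}\binom{e_1}{0}^T-\tfrac12\binom{e_1}{0}\binom{0}{f_j}^T\in\mathbb{S}^{k+n}\quad(j\in\mathcal{B}).$$ The optimal value is the infimum of the objective over the feasible set, equal to $+\infty$ if the program is infeasible. *)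

(* Defs.v *)
From HB Require Import structures.
From mathcomp Require Import all_boot all_order all_algebra.
From mathcomp Require Import all_classical all_reals all_analysis.

Set Implicit Arguments.
Unset Strict Implicit.
Unset Printing Implicit Defensive.

Import Order.TTheory GRing.Theory Num.Theory.
Import numFieldNormedType.Exports.

Local Open Scope classical_set_scope.
Local Open Scope ring_scope.

(* R^k with its Borel sigma-algebra. *)
Notation borel_cV R k := (g_sigma_algebraType (@open 'cV[R]_k)).

Section Euclidean.
Context {R : realType}.

Definition dot k (x y : 'cV[R]_k) : R := (x^T *m y) 0 0.

(* The library norm on matrices is the max norm, hence this definition. *)
Definition enorm k (x : 'cV[R]_k) : R := Num.sqrt (dot x x).

Definition eucl_dist k (x y : 'cV[R]_k) : R := enorm (x - y).

Definition is_cone k (K : set 'cV[R]_k) : Prop :=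
  forall (t : R) (x : 'cV[R]_k), 0 <= t -> K x -> K (t *: x).

Definition full_dimensional k (K : set 'cV[R]_k) : Prop := interior K !=set0.

Definition dual_cone k (K : set 'cV[R]_k) : set 'cV[R]_k :=
  [set y | forall z, K z -> 0 <= dot y z].

Definition symmetric_mx k (M : 'M[R]_k) : Prop := M^T = M.

Definition psd k (M : 'M[R]_k) : Prop :=
  symmetric_mx M /\ forall z : 'cV[R]_k, 0 <= dot z (M *m z).

Definition COP k (K : set 'cV[R]_k) : set 'M[R]_k :=
  [set M | symmetric_mx M /\ forall z, K z -> 0 <= dot z (M *m z)].

(* Inner approximation of COP(K x R^n_+) built from IA, an inner
   approximation of COP(K). *)
Definition IA_ext k n (K : set 'cV[R]_k) (IA : set 'M[R]_k) :
    set 'M[R]_(k + n) :=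
  [set T | exists S M : 'M[R]_(k + n),
     T = S + M /\ symmetric_mx S /\ symmetric_mx M /\
     IA (ulsubmx S) /\
     (forall i : 'I_n, dual_cone K (row i (dlsubmx S))^T) /\
     (forall i j : 'I_n, 0 <= drsubmx S i j) /\
     psd M].

End Euclidean.

Section Wasserstein.
Local Open Scope ereal_scope.
Context {R : realType} {k : nat}.
Local Notation T := (borel_cV R k).

(* Probability distributions supported on Xi are Borel probabilities on R^k
   giving mass 1 to Xi. *)
Definition M2 (Xi : set 'cV[R]_k) : set (probability T R) :=
  [set Q : probability T R | Q Xi = 1 /\
     exists2 xi0 : 'cV[R]_k, Xi xi0 &
       \int[Q]_(xi in Xi) ((eucl_dist xi xi0 ^+ 2)%R)%:E < +oo].

Definition coupling (Q Q' : set T -> \bar R) : set (probability (T * T)%type R) :=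
  [set Pi : probability (T * T)%type R |
            (forall U : set T, measurable U -> pushforward Pi fst U = Q U) /\
            (forall U : set T, measurable U -> pushforward Pi snd U = Q' U)].

Definition transport_cost (Xi : set 'cV[R]_k)
    (Pi : probability (T * T)%type R) : \bar R :=
  \int[Pi]_(z in Xi `*` Xi) ((eucl_dist z.1 z.2 ^+ 2)%R)%:E.

Definition W2 (Xi : set 'cV[R]_k) (Q Q' : set T -> \bar R) : \bar R :=
  ereal_inf [set (transport_cost Xi Pi) `^ (2^-1) | Pi in coupling Q Q'].

Definition empirical N (xihat : 'I_N -> 'cV[R]_k) : set T -> \bar R :=
  fun U => (N%:R^-1)%:E * \sum_(i < N) \d_(xihat i : T) U.

End Wasserstein.

Section Problem.
Context {R : realType}.

Definition feasible m n (A : 'M[R]_(m, n)) (b : 'cV[R]_m) (B : {set 'I_n}) :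
    set 'cV[R]_n :=
  [set x | A *m x = b /\ (forall j, 0 <= x j 0) /\
           (forall j, j \in B -> x j 0 = 0 \/ x j 0 = 1)].

(* The first coordinate of a vector of R^(k+1) has index 0. *)
Definition slice k (Xihat : set 'cV[R]_k.+1) : set 'cV[R]_k.+1 :=
  [set xi | Xihat xi /\ xi 0 0 = 1].

(* For X nonempty and compact, the supremum is a maximum. *)
Definition opt_val k n (F : 'M[R]_(n, k)) (X : set 'cV[R]_n)
    (xi : 'cV[R]_k) : R :=
  sup [set dot (F *m xi) x | x in X].

Definition worst_case k n N (F : 'M[R]_(n, k)) (X : set 'cV[R]_n)
    (Xi : set 'cV[R]_k) (xihat : 'I_N -> 'cV[R]_k) (eps : R) : \bar R :=
  ereal_sup [set c : \bar R | exists Q : probability (borel_cV R k) R,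
               [/\ M2 Xi Q, (W2 Xi Q (empirical xihat) <= eps%:E)%E
                 & c = (\int[Q]_(xi in Xi) (opt_val F X xi)%:E)%E]].

Definition e1 {k} : 'cV[R]_k.+1 := delta_mx 0 0.

Definition g1 {k n} : 'cV[R]_(k.+1 + n) := col_mx e1 0.

Definition Emx k m n (A : 'M[R]_(m, n)) (b : 'cV[R]_m) :
    'M[R]_(m, k.+1 + n) := row_mx (- (b *m e1^T)) A.

Definition Hmx k n (F : 'M[R]_(n, k.+1)) (xi : 'cV[R]_k.+1) (lambda : R) :
    'M[R]_(k.+1 + n) :=
  block_mx
    (- (lambda *: (1%:M - xi *m e1^T - e1 *m xi^T
                   + enorm xi ^+ 2 *: (e1 *m e1^T))))
    (2^-1 *: F^T) (2^-1 *: F) 0.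

Definition Qmx k n (j : 'I_n) : 'M[R]_(k.+1 + n) :=
  let f : 'cV[R]_(k.+1 + n) := col_mx 0 (delta_mx j 0) in
  f *m f^T - 2^-1 *: (f *m g1^T) - 2^-1 *: (g1 *m f^T).

(* The variables v^i in R^|B| are indexed through the enumeration of B. *)
Definition program_feasible k m n N (A : 'M[R]_(m, n)) (b : 'cV[R]_m)
    (F : 'M[R]_(n, k.+1)) (B : {set 'I_n}) (Xihat : set 'cV[R]_k.+1)
    (IA : set 'M[R]_k.+1) (xihat : 'I_N -> 'cV[R]_k.+1)
    (lambda : R) (alpha rho : 'I_N -> R) (u : 'I_N -> 'cV[R]_m)
    (v : 'I_N -> 'cV[R]_#|B|) : Prop :=
  [/\ forall i : 'I_N,
        IA_ext (n := n) Xihat IA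
          (alpha i *: (g1 *m g1^T) - Hmx F (xihat i) lambda
           + (Emx k A b)^T *m diag_mx (u i)^T *m Emx k A b
           + \sum_(l < #|B|) v i l 0 *: Qmx k (enum_val l)
           + (rho i)%:M),
      forall i : 'I_N, 0 <= rho i
    & 0 <= lambda].

Definition program_value k m n N (A : 'M[R]_(m, n)) (b : 'cV[R]_m)
    (F : 'M[R]_(n, k.+1)) (B : {set 'I_n}) (Xihat : set 'cV[R]_k.+1)
    (IA : set 'M[R]_k.+1) (xihat : 'I_N -> 'cV[R]_k.+1) (eps r : R) :
    \bar R :=
  ereal_inf
    [set c : \bar R |
      exists (lambda : R) (alpha rho : 'I_N -> R) (u : 'I_N -> 'cV[R]_m)
             (v : 'I_N -> 'cV[R]_#|B|),
        program_feasible A b F Xihat IA xihat lambda alpha rho u v /\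
        c = (lambda * eps ^+ 2
             + N%:R^-1 * \sum_(i < N) (alpha i + r * rho i))%:E].

End Problem.

(* Main.v *)
(** Weak duality. For xi in Xi and x in X put z = (xi, x). The matrix of the
    i-th constraint is copositive on Xihat x R^n_+, and in the resulting
    inequality the terms in E and Q_j vanish (E z = 0 and x_j^2 = x_j) while
    the identity contributes at most rho_i r; hence
      v(xi) <= alpha_i + r rho_i + lambda |xi - xihat_i|^2.
    A coupling of Q with the empirical measure is concentrated on pairs
    (xi, xihat_i), so integrating this bound against a nearly optimal coupling
    gives the objective value, up to an arbitrarily small error. *)

Require Import Defs.
From HB Require Import structures.
From mathcomp Require Import all_boot all_order all_algebra.
From mathcomp Require Import all_classical all_reals all_analysis.
From mathcomp Require Import measurable_realfun lra.

Set Implicit Arguments.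
Unset Strict Implicit.
Unset Printing Implicit Defensive.

Import Order.TTheory GRing.Theory Num.Theory.
Import numFieldNormedType.Exports.

Local Open Scope classical_set_scope.
Local Open Scope ring_scope.

(** * Inner product algebra and elementary norm inequalities *)

Section Dot.
Context {R : realType}.

Lemma dotE k (x y : 'cV[R]_k) : dot x y = \sum_i x i 0 * y i 0.
Proof. by rewrite /dot mxE; apply: eq_bigr => i _; rewrite mxE. Qed.

Lemma dotC k (x y : 'cV[R]_k) : dot x y = dot y x.
Proof. by rewrite !dotE; apply: eq_bigr => i _; rewrite mulrC. Qed.

Lemma dotDl k (x y z : 'cV[R]_k) : dot (x + y) z = dot x z + dot y z.
Proof. by rewrite /dot linearD /= mulmxDl mxE. Qed.

Lemma dotDr k (x y z : 'cV[R]_k) : dot x (y + z) = dot x y + dot x z.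
Proof. by rewrite dotC dotDl !(dotC x). Qed.

Lemma dotZl k a (x y : 'cV[R]_k) : dot (a *: x) y = a * dot x y.
Proof. by rewrite /dot linearZ /= -scalemxAl mxE. Qed.

Lemma dotZr k a (x y : 'cV[R]_k) : dot x (a *: y) = a * dot x y.
Proof. by rewrite dotC dotZl dotC. Qed.

Lemma dotNl k (x y : 'cV[R]_k) : dot (- x) y = - dot x y.
Proof. by rewrite -scaleN1r dotZl mulN1r. Qed.

Lemma dotNr k (x y : 'cV[R]_k) : dot x (- y) = - dot x y.
Proof. by rewrite dotC dotNl dotC. Qed.

Lemma dot0l k (x : 'cV[R]_k) : dot 0 x = 0.
Proof. by rewrite -(scale0r 0) dotZl mul0r. Qed.

Lemma dot0r k (x : 'cV[R]_k) : dot x 0 = 0.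
Proof. by rewrite dotC dot0l. Qed.

Lemma dot_sumr k (I : Type) (s : seq I) (f : I -> 'cV[R]_k) (x : 'cV[R]_k) :
  dot x (\sum_(i <- s) f i) = \sum_(i <- s) dot x (f i).
Proof.
by apply: (big_morph (dot x)) => [y z|]; rewrite ?dotDr ?dot0r.
Qed.

Lemma dot_ge0 k (x : 'cV[R]_k) : 0 <= dot x x.
Proof. by rewrite dotE; apply: sumr_ge0 => i _; rewrite -expr2 sqr_ge0. Qed.

Lemma dot_mulmxr p q (x : 'cV[R]_p) (M : 'M[R]_(p, q)) (y : 'cV[R]_q) :
  dot x (M *m y) = dot (M^T *m x) y.
Proof. by rewrite /dot trmx_mul trmxK mulmxA. Qed.

Lemma dot_col_mx p q (x x' : 'cV[R]_p) (y y' : 'cV[R]_q) :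
  dot (col_mx x y) (col_mx x' y') = dot x x' + dot y y'.
Proof. by rewrite /dot tr_col_mx mul_row_col mxE. Qed.

Lemma dot_delta p (i : 'I_p) (x : 'cV[R]_p) : dot (delta_mx i 0) x = x i 0.
Proof.
rewrite dotE (bigD1 i) //= mxE !eqxx mul1r big1 ?addr0 // => j ji.
by rewrite mxE (negPf ji) mul0r.
Qed.

(** The constraint matrices are built largely from rank-one terms; this turns their quadratic forms
    into products of inner products. *)
Lemma mulmx_outer p q (a : 'cV[R]_p) (c z : 'cV[R]_q) :
  (a *m c^T) *m z = dot c z *: a.
Proof. by rewrite -mulmxA [c^T *m z]mx11_scalar mul_mx_scalar. Qed.

Lemma dot_double k (x y : 'cV[R]_k) : 2 * dot x y <= dot x x + dot y y.
Proof.
have := dot_ge0 (x - y).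
rewrite !(dotDl, dotDr, dotNl, dotNr) (dotC y x); lra.
Qed.

Lemma enorm_sqr k (x : 'cV[R]_k) : enorm x ^+ 2 = dot x x.
Proof. by rewrite sqr_sqrtr ?dot_ge0. Qed.

Lemma eucl_dist_sqr_le k (x y : 'cV[R]_k) :
  eucl_dist x y ^+ 2 <= 2 * (dot x x + dot y y).
Proof.
rewrite enorm_sqr !(dotDl, dotDr, dotNl, dotNr) (dotC y x).
have := dot_double x (- y); rewrite !(dotNl, dotNr); lra.
Qed.

End Dot.

(** * Quadratic forms of the constraint matrices at [z = (xi, x)] *)

Section PointwiseBound.
Context {R : realType}.

(** Split [T = S + M] with [M] positive semidefinite. In [S], the block [S11] is copositive on [K],
    the entries of [S21 xi] pair dual-cone rows with [xi], and [S22] is entrywise nonnegative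
    against [x >= 0]. *)
Lemma IA_ext_ge0 k n (K : set 'cV[R]_k) (IA : set 'M[R]_k) T xi (x : 'cV[R]_n) :
  IA `<=` COP K -> IA_ext K IA T -> K xi -> (forall j, 0 <= x j 0) ->
  0 <= dot (col_mx xi x) (T *m col_mx xi x).
Proof.
move=> IAK [S [M [-> [symS [_ [/IAK[_ S11] [S21 [S22 [_ psdM]]]]]]]]] Kxi x0.
rewrite mulmxDl dotDr addr_ge0//.
(* By symmetry both off-diagonal blocks contribute the same term. *)
have S12 : ursubmx S = (dlsubmx S)^T by rewrite trmx_dlsub symS.
rewrite -[S]submxK S12 mul_block_col dot_col_mx !dotDr.
rewrite (dot_mulmxr xi (dlsubmx S)^T) trmxK.
have S21_ge0 : 0 <= dot x (dlsubmx S *m xi).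
  rewrite dotE sumr_ge0// => i _; rewrite mulr_ge0//.
  have := S21 i _ Kxi; rewrite /dot trmxK.
  by rewrite -row_mul mxE.
rewrite (dotC _ x) !addr_ge0 ?S11//.
rewrite dotE sumr_ge0// => i _; rewrite mulr_ge0// mxE sumr_ge0// => j _.
by rewrite mulr_ge0.
Qed.

Variables (k m n : nat) (A : 'M[R]_(m, n)) (b : 'cV[R]_m).
Variables (F : 'M[R]_(n, k.+1)) (xi : 'cV[R]_k.+1) (x : 'cV[R]_n).
Hypothesis xi1 : xi 0 0 = 1.

Let z := col_mx xi x.

Lemma dot_g1 : dot g1 z = 1.
Proof. by rewrite dot_col_mx dot0l addr0 dot_delta. Qed.

Lemma quad_g1 : dot z ((g1 *m g1^T) *m z) = 1.
Proof. by rewrite mulmx_outer dot_g1 scale1r dotC dot_g1. Qed.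

(** The upper-left block is [- lambda] times the form of [|xi - xi_1 xi'|^2], and [xi_1 = 1]. The
    two halves of [F] add up to the bilinear term. *)
Lemma quad_Hmx xi' lambda :
  dot z (Hmx F xi' lambda *m z) =
  dot (F *m xi) x - lambda * eucl_dist xi xi' ^+ 2.
Proof.
rewrite mul_block_col dot_col_mx mul0mx addr0 dotDr -!scalemxAl !dotZr.
rewrite (dot_mulmxr xi F^T) trmxK (dotC x) mulNmx dotNr -scalemxAl dotZr.
rewrite !enorm_sqr !mulmxDl !mulNmx -scalemxAl mul1mx !mulmx_outer.
have xi_e1 : dot e1 xi = 1 by rewrite dot_delta.
rewrite !(dotDl, dotDr, dotNl, dotNr, dotZr) (dotC xi e1) xi_e1 (dotC xi' xi).
lra.
Qed.

(** [Emx] homogenizes the equation: its value at [z] is [A x - xi_1 b]. *)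
Lemma mul_Emx : A *m x = b -> Emx k A b *m z = 0.
Proof.
move=> Axb; rewrite mul_row_col mulNmx mulmx_outer Axb dot_delta xi1.
by rewrite scale1r addNr.
Qed.

(** The form equals [x_j^2 - x_j], because [g1] pairs with [z] to 1. *)
Lemma quad_Qmx j : x j 0 = 0 \/ x j 0 = 1 -> dot z (Qmx k j *m z) = 0.
Proof.
have fz : dot (col_mx 0 (delta_mx j 0)) z = x j 0.
  by rewrite dot_col_mx dot0l add0r dot_delta.
move=> xj; rewrite !mulmxBl -!scalemxAl !mulmx_outer !(dotDr, dotNr, dotZr).
rewrite !(dotC z) dot_g1 fz.
by case: xj => ->; lra.
Qed.

End PointwiseBound.

Lemma program_feasible_bound (R : realType) k m n N (A : 'M[R]_(m, n)) b
    (F : 'M[R]_(n, k.+1)) (B : {set 'I_n}) Xihat IA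
    (xihat : 'I_N -> 'cV[R]_k.+1) r lambda alpha rho u v i xi x :
  (forall (xi : 'cV[R]_k.+1) (x : 'cV[R]_n),
     slice Xihat xi -> feasible A b B x -> dot xi xi + dot x x <= r) ->
  IA `<=` COP Xihat ->
  program_feasible A b F (B := B) Xihat IA xihat lambda alpha rho u v ->
  slice Xihat xi -> feasible A b B x ->
  dot (F *m xi) x <=
    alpha i + r * rho i + lambda * eucl_dist xi (xihat i) ^+ 2.
Proof.
move=> r_bound IAK [ia rho0 _] xiX xX.
have [Kxi xi1] := xiX; have [Axb [x0 xB]] := xX.
have := IA_ext_ge0 IAK (ia i) Kxi x0.
rewrite !mulmxDl !dotDr -scalemxAl dotZr quad_g1// mulNmx dotNr quad_Hmx//.
rewrite -!mulmxA mul_Emx// !mulmx0 dot0r mulmx_suml dot_sumr.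
rewrite big1 ?addr0 => [|l _]; last first.
  by rewrite -scalemxAl dotZr quad_Qmx ?mulr0//; apply/xB/enum_valP.
rewrite mul_scalar_mx dotZr dot_col_mx.
have := ler_wpM2l (rho0 i) (r_bound _ _ xiX xX).
lra.
Qed.

(** * Borel measurability on column vectors *)

Section Borel.
Context {R : realType} {k : nat}.
Local Notation T := (borel_cV R k).

Lemma open_borel (U : set 'cV[R]_k) : open U -> measurable (U : set T).
Proof. exact: sub_sigma_algebra. Qed.

Lemma closed_borel (U : set 'cV[R]_k) : closed U -> measurable (U : set T).
Proof.
move=> cU; rewrite -[U]setCK.
by apply: (@measurableC _ T); apply: open_borel; exact: closed_openC.
Qed.

Lemma set1_borel (a : 'cV[R]_k) : measurable ([set a] : set T).
Proof.
apply: closed_borel; apply: accessible_closed_set1.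
exact/hausdorff_accessible/norm_hausdorff.
Qed.

(** Open upper rays generate the Borel sets of the line, so their preimages decide measurability. *)
Lemma lower_semicontinuous_borel (f : 'cV[R]_k -> R) :
  (forall a, open [set x | a < f x]) -> measurable_fun setT (f : T -> R).
Proof.
move=> f_open; apply: (measurability _ (RGenOInfty.measurableE R)).
move=> _ [_ [a ->] <-]; rewrite setTI; apply: open_borel.
rewrite (_ : _ @^-1` _ = [set x | a < f x])//.
by apply/seteqP; split => x /=; rewrite in_itv/= andbT.
Qed.

Lemma continuous_borel (f : 'cV[R]_k -> R) :
  continuous f -> measurable_fun setT (f : T -> R).
Proof.
move=> cf; apply: lower_semicontinuous_borel => a.
by apply: (@open_comp _ _ f [set y | a < y]) => //; exact: open_gt.
Qed.

Lemma continuous_dot (w : 'cV[R]_k) : continuous (fun x => dot x w).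
Proof.
under eq_fun do rewrite dotE.
apply: continuous_big => [xy|i _]; first exact: add_continuous.
have ci : continuous (fun x : 'cV[R]_k => x i 0) by exact: coord_continuous.
by move=> x; apply: continuousM; [exact: ci|exact: cst_continuous].
Qed.

(** [T * T] carries the product sigma-algebra, so the function is assembled from measurable
    coordinates rather than from joint continuity. *)
Lemma measurable_eucl_dist_sqr :
  measurable_fun [set: T * T] (fun z => eucl_dist z.1 z.2 ^+ 2 : R).
Proof.
rewrite (_ : (fun z => _) = fun z : T * T =>
    \sum_i ((z.1 : 'cV[R]_k) i 0 - (z.2 : 'cV[R]_k) i 0) ^+ 2); last first.
  apply/funext => z; rewrite enorm_sqr dotE; apply: eq_bigr => i _.
  by rewrite !mxE expr2.
have mc i : measurable_fun setT ((fun x => x i 0) : T -> R).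
  by apply: continuous_borel; exact: coord_continuous.
apply: measurable_sum => i; apply: measurable_funX; apply: measurable_funB.
- by apply: (measurableT_comp (mc i)); exact: measurable_fst.
- by apply: (measurableT_comp (mc i)); exact: measurable_snd.
Qed.

End Borel.

(** * Integration against a coupling with the empirical measure *)

Section CouplingBound.
Local Open Scope ereal_scope.
Context {R : realType} {k N : nat}.
Local Notation T := (borel_cV R k).
Variables (Xi : set 'cV[R]_k) (xihat : 'I_N -> 'cV[R]_k).
Hypotheses (mXi : measurable (Xi : set T)) (xihat_in : forall i, Xi (xihat i)).
Variables (Q : probability T R) (Pi : probability (T * T)%type R).
Hypotheses (QXi : Q Xi = 1) (PiQ : coupling Q (empirical xihat) Pi).

(* Multiplicity of the atom [xihat i]: the samples may coincide. *)
Let m i : nat := #|[pred j | xihat j == xihat i]|.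

Let m_gt0 i : (0 < m i)%N.
Proof. by apply/card_gt0P; exists i; rewrite inE. Qed.

Lemma empirical_atom i : empirical xihat [set xihat i] = ((m i)%:R / N%:R)%:E.
Proof.
rewrite /empirical; under eq_bigr do rewrite diracE.
rewrite sumEFin -EFinM mulrC; congr (_ / _)%:E.
rewrite /m -sum1_card natr_sum [RHS]big_mkcond/=; apply: eq_bigr => j _.
rewrite inE; case: eqVneq => [->|ji]; first by rewrite mem_set.
by rewrite memNset//= => /eqP; rewrite (negPf ji).
Qed.

(** The pairs (point of [Xi], sample), on which the pointwise bound applies. Both marginals force
    [Pi] to be concentrated here. *)
Let D := (fst @^-1` Xi `&` snd @^-1` (range xihat)) : set (T * T).

Let mrange : measurable (range xihat : set T).
Proof.
rewrite -bigcup_imset1; apply: fin_bigcup_measurable => // i _.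
exact: set1_borel.
Qed.

Let mfstXi : measurable (fst @^-1` Xi : set (T * T)).
Proof. by rewrite -[X in measurable X]setTI; exact: measurable_fst. Qed.

Let msnd (U : set T) : measurable U -> measurable (snd @^-1` U : set (T * T)).
Proof.
by move=> mU; rewrite -[X in measurable X]setTI; exact: measurable_snd.
Qed.

Let mD : measurable D.
Proof. by apply: measurableI => //; exact: msnd. Qed.

Let PifstC : Pi (~` (fst @^-1` Xi)) = 0.
Proof.
have [PQ _] := PiQ; have := PQ _ mXi; rewrite /pushforward QXi => PiXi.
by rewrite probability_setC// PiXi subee.
Qed.

Let PisndC : Pi (~` (snd @^-1` range xihat)) = 0.
Proof.
have [_ /(_ (~` range xihat))] := PiQ; rewrite /pushforward => ->; last first.
  exact: measurableC.
rewrite /empirical big1 ?mule0// => i _.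
rewrite diracE memNset//= => /(_ _); apply; exists i => //.
Qed.

Lemma integrable_bounded (v : T * T -> R) (B : set (T * T)) (C : R) :
  measurable B -> measurable_fun B v -> (forall z, B z -> `|v z| <= C)%R ->
  Pi.-integrable B (EFin \o v).
Proof.
move=> mB mv vC; apply: measurable_bounded_integrable => //.
  by rewrite (le_lt_trans (probability_le1 Pi mB))// ltry.
exists C; split; first exact: num_real.
by move=> M CM z Bz /=; rewrite (le_trans (vC _ Bz))// ltW.
Qed.

(** [Q] is the image of [Pi] under [fst]; after this change of variables, discarding the null set
    where the second component is not a sample leaves [D]. *)
Lemma integral_fst_coupling (v : 'cV[R]_k -> R) (C : R) :
  measurable_fun setT (v : T -> R) -> (forall x, Xi x -> `|v x| <= C)%R ->
  \int[Q]_(x in Xi) (v x)%:E = \int[Pi]_(z in D) (v z.1)%:E.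
Proof.
move=> mv vC; have [PQ _] := PiQ.
have mv1 : measurable_fun setT ((fun z => v z.1) : T * T -> R).
  by apply: (measurableT_comp mv); exact: measurable_fst.
have iv : Pi.-integrable (fst @^-1` Xi) (fun z => (v z.1)%:E).
  apply: (@integrable_bounded _ _ C) => //; first exact: measurable_funTS.
  by move=> z; exact: vC.
rewrite (@eq_measure_integral _ _ _ _ (pushforward Pi fst)); last first.
  by move=> A mA _; exact/esym/PQ.
rewrite integral_pushforward//; last by apply/measurable_EFinP; exact: mv.
rewrite (negligible_integral (measurableC (msnd mrange)) mfstXi iv PisndC).
by rewrite setDE setCK.
Qed.

(** The second marginal gives the fibre over [xihat i] its empirical mass, and the part of the fibre
    outside [D] is null by [PifstC]. *)
Let Pi_atom i : Pi (snd @^-1` [set xihat i] `&` D) = ((m i)%:R / N%:R)%:E.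
Proof.
have ma : measurable (snd @^-1` [set xihat i] : set (T * T)).
  by apply: msnd; exact: set1_borel.
have [_ PE] := PiQ; rewrite -empirical_atom -PE; last exact: set1_borel.
rewrite /pushforward [RHS](measureDI _ ma mfstXi).
rewrite [X in _ = X + _](_ : _ = 0); last first.
  by apply: (subset_measure0 _ _ _ PifstC);
    [exact: measurableD|exact: measurableC|move=> z []].
rewrite add0e; congr (Pi _); apply/seteqP; split=> z /= [zi]; first by case.
by move=> zXi; do 2 split=> //; exists i.
Qed.

(* The right-hand side is the average of [phi] over all samples equal to
   [xihat i]; weighting by [(m j)^-1] makes it a function of the atom only. *)
Lemma le_atoms (phi : 'I_N -> R) i (c : R) :
  (forall j, xihat j = xihat i -> c <= phi j)%R ->
  (c <= \sum_j phi j / (m j)%:R * \1_[set xihat j] (xihat i))%R.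
Proof.
move=> c_le.
rewrite (eq_bigr (fun j =>
    if xihat j == xihat i then phi j / (m i)%:R else 0)%R); last first.
  move=> j _; rewrite indicE; case: eqVneq => [ji|/eqP ji].
    by rewrite /m ji mem_set// mulr1.
  by rewrite memNset ?mulr0// => /esym.
rewrite -big_mkcond/= -mulr_suml ler_pdivlMr ?ltr0n//.
rewrite mulr_natr -sumr_const; apply: ler_sum => j.
by rewrite inE => /eqP; exact: c_le.
Qed.

Let matom i : measurable (snd @^-1` [set xihat i] : set (T * T)).
Proof. by apply: msnd; exact: set1_borel. Qed.

Let integrable_atom (c : R) i :
  Pi.-integrable D (fun z => (c * \1_[set xihat i] (z.2 : 'cV[R]_k))%:E).
Proof.
apply: (@integrable_bounded (fun z =>
    c * \1_[set xihat i] (z.2 : 'cV[R]_k))%R _ `|c|%R) => //.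
  apply: measurable_funM => //.
  exact: (@measurable_indic _ _ _ D _ (matom i)).
move=> z _; rewrite normrM ler_piMr// indicE.
by case: (_ \in _); rewrite ?normr0 ?normr1.
Qed.

(** The mass [m i / N] of an atom cancels the weight [(m i)^-1], so each sample counts exactly
    [1 / N] even when samples coincide. *)
Lemma integral_atoms (phi : 'I_N -> R) :
  \int[Pi]_(z in D)
    (\sum_i phi i / (m i)%:R * \1_[set xihat i] (z.2 : 'cV[R]_k))%:E =
  (N%:R^-1 * \sum_i phi i)%:E.
Proof.
under eq_integral do rewrite -sumEFin.
rewrite integral_sum// mulr_sumr -sumEFin; apply: eq_bigr => i _.
under eq_integral do rewrite EFinM.
rewrite integralZl//; last first.
  apply: (integrableS measurableT) => //.
  exact: (@integrable_indic _ _ _ _ _ (matom i)).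
rewrite [X in _ * X](_ : _ = ((m i)%:R / N%:R)%:E); last first.
  by rewrite (@integral_indic _ _ _ _ D _ _ (matom i))//; exact: Pi_atom.
by rewrite -EFinM mulrA divfK ?pnatr_eq0 -?lt0n// mulrC.
Qed.

(** Integrate the pointwise bound over [D]: the distance term gives at most the transport cost, the
    [phi] term gives the sample average. The bounds on [v] and [Xi] provide integrability. *)
Lemma coupling_bound (v : 'cV[R]_k -> R) (phi : 'I_N -> R) (C lambda : R) :
  measurable_fun setT (v : T -> R) -> (forall x, Xi x -> `|v x| <= C)%R ->
  (0 <= lambda)%R ->
  (forall i x, Xi x -> v x <= phi i + lambda * eucl_dist x (xihat i) ^+ 2)%R ->
  (exists r : R, forall x, Xi x -> dot x x <= r)%R ->
  \int[Q]_(x in Xi) (v x)%:E <=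
  lambda%:E * transport_cost Xi Pi + (N%:R^-1 * \sum_i phi i)%:E.
Proof.
move=> mv vC lambda0 v_le [r Xir].
rewrite (integral_fst_coupling mv vC) -integral_atoms.
pose d (z : T * T) : R := (eucl_dist z.1 z.2 ^+ 2)%R.
have md := @measurable_eucl_dist_sqr R k.
have d_ge0 z : (0 <= d z)%R by rewrite /d sqr_ge0.
have mXX : measurable (Xi `*` Xi : set (T * T)) by exact: measurableX.
have DXX : D `<=` Xi `*` Xi by move=> z [z1 [i _ iz]]; split=> //; rewrite -iz.
have id : Pi.-integrable (Xi `*` Xi) (EFin \o d).
  apply: (@integrable_bounded _ _ (4 * r)) => //; first exact: measurable_funTS.
  move=> z [z1 z2]; rewrite ger0_norm//.
  apply: (le_trans (eucl_dist_sqr_le _ _)).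
  by have := Xir _ z1; have := Xir _ z2; lra.
pose g (z : T * T) : R :=
  (\sum_i phi i / (m i)%:R * \1_[set xihat i] (z.2 : 'cV[R]_k))%R.
have vD : Pi.-integrable D (fun z => (v z.1)%:E).
  apply: (@integrable_bounded _ _ C) => //; last by move=> z [z1 _]; exact: vC.
  apply: measurable_funTS; apply: (measurableT_comp mv).
  exact: measurable_fst.
have gD : Pi.-integrable D (EFin \o g).
  rewrite (_ : _ \o _ = fun z => \sum_i
      (phi i / (m i)%:R * \1_[set xihat i] (z.2 : 'cV[R]_k))%:E); last first.
    by apply/funext => z; rewrite sumEFin.
  exact: integrable_sum.
have dD : Pi.-integrable D (fun z => lambda%:E * (d z)%:E).
  by apply: integrableZl => //; exact: integrableS id.
apply: (@le_trans _ _ (\int[Pi]_(z in D) (lambda%:E * (d z)%:E + (g z)%:E))).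
  apply: le_integral => //; first exact: integrableD.
  move=> z; rewrite inE => -[z1 [i _ iz]].
  (* On [D] the second component is some [xihat i]; the bound holds for every sample [j] at that
     atom, hence for their average. *)
  rewrite -EFinM -EFinD lee_fin -lerBlDl /g -iz; apply: le_atoms => j ji.
  by rewrite lerBlDr /d -iz -ji; exact: v_le.
rewrite integralD// leeD2r// integralZl//; last exact: integrableS id.
rewrite lee_wpmul2l ?lee_fin//.
(* The cost integrates a nonnegative function over [Xi * Xi], which contains [D]. *)
apply: ge0_subset_integral => //; first exact: measurable_int id.
by move=> z _; rewrite lee_fin.
Qed.

End CouplingBound.

(** * Boundedness and measurability of the optimal value function *)

Section OptVal.
Context {R : realType} {k n : nat}.
Variables (F : 'M[R]_(n, k)) (X : set 'cV[R]_n) (r : R).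
Hypotheses (X_neq0 : X !=set0) (Xr : forall x, X x -> dot x x <= r).

Lemma opt_val_has_ubound xi : has_ubound [set dot (F *m xi) x | x in X].
Proof.
exists ((dot (F *m xi) (F *m xi) + r) / 2) => _ [x Xx <-].
by have := dot_double (F *m xi) x; have := Xr Xx; lra.
Qed.

Lemma le_opt_val xi x : X x -> dot (F *m xi) x <= opt_val F X xi.
Proof.
by move=> Xx; apply: ub_le_sup; [exact: opt_val_has_ubound|exists x].
Qed.

Lemma opt_val_le xi c : (forall x, X x -> dot (F *m xi) x <= c) ->
  opt_val F X xi <= c.
Proof.
move=> Xc; apply: ge_sup; last by move=> _ [x Xx <-]; exact: Xc.
by have [x Xx] := X_neq0; exists (dot (F *m xi) x), x.
Qed.

Lemma dot_mulmxl (xi : 'cV[R]_k) x : dot (F *m xi) x = dot xi (F^T *m x).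
Proof. by rewrite dot_mulmxr trmxK. Qed.

(** A supremum of linear functions of [xi] is lower semicontinuous: each strict superlevel set is a
    union of open half-spaces indexed by [X]. *)
Lemma measurable_opt_val :
  measurable_fun setT (opt_val F X : borel_cV R k -> R).
Proof.
apply: lower_semicontinuous_borel => a.
rewrite (_ : [set _ | _] =
    \bigcup_(x in X) [set xi | a < dot xi (F^T *m x)]); last first.
  apply/seteqP; split => xi /=.
    move=> /sup_gt[|_ [x Xx <-] ax]; last by exists x; rewrite //= -dot_mulmxl.
    by have [x Xx] := X_neq0; exists (dot (F *m xi) x), x.
  move=> [x Xx /=]; rewrite -dot_mulmxl => /lt_le_trans; apply.
  exact: le_opt_val.
apply: bigcup_open => x _.
apply: (@open_comp _ _ (fun xi => dot xi (F^T *m x)) [set y | a < y]).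
  by move=> xi _; exact: continuous_dot.
exact: open_gt.
Qed.

End OptVal.

(** * Near-optimal couplings and the final estimate *)

(** An infimum below [s] has a member below [s]; the slack [eps < s] thus yields a coupling without
    any claim that the infimum is attained. *)
Lemma W2_le_coupling (R : realType) k (Xi : set 'cV[R]_k) Q Q' (eps s : R) :
  (W2 Xi Q Q' <= eps%:E)%E -> eps < s ->
  exists2 Pi, coupling Q Q' Pi & (transport_cost Xi Pi <= (s ^+ 2)%:E)%E.
Proof.
move=> WQ eps_s.
have /ereal_inf_lt[_ [Pi PiQ <-]] : (W2 Xi Q Q' < s%:E)%E.
  by rewrite (le_lt_trans WQ)// lte_fin.
move=> cost_lt; exists Pi => //; have : (0 <= transport_cost Xi Pi)%E.
  by apply: integral_ge0 => z _; rewrite lee_fin sqr_ge0.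
have half_neq0 : 2^-1 != 0 :> R by rewrite invr_eq0.
(* A finite square root means a finite cost, so the rest is a computation with real numbers. *)
have := lty_poweRy half_neq0 (lt_trans cost_lt (ltry s)).
case: (transport_cost Xi Pi) cost_lt => [c| |]//.
rewrite poweR_EFin lte_fin !lee_fin.
move=> + _ c0; rewrite powR12_sqrt// => cs.
have s0 : 0 <= s by rewrite (le_trans (sqrtr_ge0 c))// ltW.
by rewrite -[c]sqr_sqrtr// ler_pXn2r ?nnegrE ?sqrtr_ge0// ltW.
Qed.

Theorem theorem1 (R : realType) (k m n N : nat)
  (A : 'M[R]_(m, n)) (F : 'M[R]_(n, k.+1)) (b : 'cV[R]_m) (B : {set 'I_n})
  (Xihat : set 'cV[R]_k.+1)
  (Xihat_sub : forall xi : 'cV[R]_k.+1, Xihat xi -> 0 <= xi 0 0)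
  (Xihat_closed : closed Xihat)
  (Xihat_convex : convex_set Xihat)
  (Xihat_full : full_dimensional Xihat)
  (Xihat_cone : is_cone Xihat)
  (Xi_neq0 : slice Xihat !=set0)
  (X_neq0 : feasible A b B !=set0)
  (X_bounded : bounded_set (feasible A b B))
  (relax_bound : forall x : 'cV[R]_n, A *m x = b -> (forall j, 0 <= x j 0) ->
     forall j, j \in B -> 0 <= x j 0 <= 1)
  (Xi_bounded : bounded_set (slice Xihat))
  (N_gt0 : (0 < N)%N)
  (xihat : 'I_N -> 'cV[R]_k.+1)
  (xihat_in : forall i, slice Xihat (xihat i))
  (eps : R) (eps_gt0 : 0 < eps)
  (r : R) (r_gt0 : 0 < r)
  (r_bound : forall (xi : 'cV[R]_k.+1) (x : 'cV[R]_n),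
     slice Xihat xi -> feasible A b B x -> dot xi xi + dot x x <= r)
  (IA : set 'M[R]_k.+1)
  (IA_sub : IA `<=` COP Xihat) :
  (worst_case F (feasible A b B) (slice Xihat) xihat eps
    <= program_value A b F B Xihat IA xihat eps r)%E.

Proof.
have Xi_r xi : slice Xihat xi -> dot xi xi <= r.
  move=> xiX; have [x xX] := X_neq0.
  by apply: le_trans (r_bound _ _ xiX xX); rewrite lerDl dot_ge0.
have X_r x : feasible A b B x -> dot x x <= r.
  move=> xX; have [xi xiX] := Xi_neq0.
  by apply: le_trans (r_bound _ _ xiX xX); rewrite lerDr dot_ge0.
have mXi : measurable (slice Xihat : set (borel_cV R k.+1)).
  apply: closed_borel; apply: closedI => //.
  apply: (@preimage_closed _ _ (fun xi : 'cV[R]_k.+1 => xi 0 0) [set y | y = 1]).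
    by move=> xi _; exact: coord_continuous.
  exact: closed_eq.
apply: ge_ereal_sup => _ [Q [[QXi _] WQ ->]].
apply: le_ereal_inf_tmp => _ [lambda [alpha [rho [u [v [feas ->]]]]]].
have [_ _ lambda0] := feas.
pose phi i := alpha i + r * rho i.
have v_le i xi : slice Xihat xi -> opt_val F (feasible A b B) xi <=
    phi i + lambda * eucl_dist xi (xihat i) ^+ 2.
  move=> xiX; apply: opt_val_le => // x xX.
  exact: program_feasible_bound r_bound IA_sub feas xiX xX.
have [C v_bounded] : exists C, forall xi, slice Xihat xi ->
    `|opt_val F (feasible A b B) xi| <= C.
  have [x xX] := X_neq0; pose i0 := Ordinal N_gt0.
  (* The first two terms bound the value from above, by [v_le] at the sample [i0]; the last bounds
     it from below, through the fixed feasible [x] and [dot_double]. *)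
  exists (`|phi i0| + lambda * (4 * r) + (r + dot (F^T *m x) (F^T *m x)) / 2).
  move=> xi xiX; rewrite ler_norml; apply/andP; split.
    apply: le_trans (le_opt_val _ X_r _ xX); rewrite (dot_mulmxl F xi).
    have := dot_double (- xi) (F^T *m x); rewrite !(dotNl, dotNr) opprK.
    have := Xi_r _ xiX; have := normr_ge0 (phi i0).
    have := mulr_ge0 lambda0 (ltW r_gt0); lra.
  apply: (le_trans (v_le i0 _ xiX)).
  have d_le : eucl_dist xi (xihat i0) ^+ 2 <= 4 * r.
    have := eucl_dist_sqr_le xi (xihat i0).
    by have := Xi_r _ xiX; have := Xi_r _ (xihat_in i0); lra.
  have := ler_wpM2l lambda0 d_le; have := ler_norm (phi i0).
  have := dot_ge0 (F^T *m x); lra.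
apply/lee_addgt0Pr => e e0.
(* For [delta <= 1], [(eps + delta)^2 - eps^2 <= delta * (2 * eps + 1)], so the excess cost times
   [lambda] is at most [e]. The final [+ 1] keeps the denominator positive when [lambda = 0]. *)
pose delta := Num.min 1 (e / (lambda * (2 * eps + 1) + 1)).
have den_gt0 : 0 < lambda * (2 * eps + 1) + 1.
  have : 0 <= lambda * (2 * eps + 1) by apply: mulr_ge0 => //; lra.
  lra.
have delta_gt0 : 0 < delta by rewrite lt_min ltr01 divr_gt0.
have [Pi PiQ cost_le] := W2_le_coupling WQ (ltr_pwDr delta_gt0 (lexx eps)).
apply: le_trans (coupling_bound mXi xihat_in QXi PiQ
  (measurable_opt_val F X_neq0 X_r) v_bounded lambda0 v_le _) _.
  by exists r.
apply: (@le_trans _ _ (lambda%:E * ((eps + delta) ^+ 2)%:E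
    + (N%:R^-1 * \sum_i phi i)%:E)%E).
  by rewrite leeD2r// lee_wpmul2l ?lee_fin.
rewrite -EFinM -!EFinD lee_fin addrAC lerD2r.
have delta1 : delta <= 1 by rewrite ge_min lexx.
have : delta * (lambda * (2 * eps + 1) + 1) <= e.
  by rewrite -ler_pdivlMr// ge_min lexx orbT.
nra.
Qed.
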